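(* Let $n \ge 1$. If the sphere $S^n$ is divided into two measurable subsets $A$ and $\overline A = S^n \setminus A$ of equal $n$-area, $\mu(A) = \mu(\overline A)$, then these two subsets have the same distribution of distance, i.e. $st_A = st_{\overline A}$.
   Context: $S^n \subset \mathbb{R}^{n+1}$ is the sphere of unit radius, $\mu$ is its $n$-dimensional surface measure ($n$-area), and $d_E$ is the Euclidean distance of $\mathbb{R}^{n+1}$ restricted to $S^n$. $H$ is the Heaviside function, $H(x)=1$ for $x>0$ and $H(x)=0$ otherwise. For a measurable set $A \subset S^n$, the cumulative measure function of distance is $St_A(\ell) = \int_A d\mu(x) \int_A d\mu(y)\, H(\ell - d_E(x,y))$, and the measure density function of distance $st_A$ is its derivative with respect to $\ell$. It is understood as a density on the line of distances (defined almost everywhere), so that $st_A = st_B$ is equivalent to $St_A = St_B$. *)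

(* Defs.v *)
From HB Require Import structures.
From mathcomp Require Import all_boot all_order all_algebra.
From mathcomp Require Import all_classical all_reals all_analysis.

Set Implicit Arguments.
Unset Strict Implicit.
Unset Printing Implicit Defensive.

Import Order.TTheory GRing.Theory Num.Theory.
Import numFieldNormedType.Exports.

Local Open Scope classical_set_scope.
Local Open Scope ring_scope.

(* Volume of the unit ball of R^n, by
   omega_0 = 1, omega_1 = 2, omega_(k+2) = (2 pi / (k+2)) omega_k. *)
Fixpoint unit_ball_volume (R : realType) (n : nat) : R :=
  match n with
  | 0 => 1
  | 1 => 2
  | (k.+1 as m).+1 => 2 * pi / m.+1%:R * unit_ball_volume R k
  end.

Lemma unit_ball_volume_gt0 (R : realType) n : 0 < unit_ball_volume R n.
Proof.
suff : 0 < unit_ball_volume R n /\ 0 < unit_ball_volume R n.+1 by case.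
elim: n => [|n [ih1 ih2]]; first by split.
by split => //=; rewrite !mulr_gt0// ?pi_gt0// invr_gt0.
Qed.

(* T with all subsets measurable; only used to get the sigma-subadditivity of
   the Hausdorff outer measure from that of mu_ext. *)
Definition discreteT (T : Type) : Type := T.
HB.instance Definition _ (T : pointedType) := Pointed.on (discreteT T).
HB.instance Definition _ (T : pointedType) :=
  @isMeasurable.Build default_measure_display (discreteT T)
  (@discrete_measurable T) (@discrete_measurable0 T)
  (@discrete_measurableC T) (@discrete_measurableU T).

(* The n-dimensional Hausdorff outer measure of a set T with distance function
   d, normalised so as to be the n-area (Lebesgue measure on R^n). *)
Section hausdorff.
Local Open Scope ereal_scope.
Context {R : realType} {T : pointedType}.
Variables (d : T -> T -> R) (n : nat).

(* -oo on the empty set *)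
Definition diam (X : set T) : \bar R :=
  ereal_sup [set (d p.1 p.2)%:E | p in X `*` X].

Definition hausdorff_gauge (X : set T) : \bar R :=
  if X == set0 then 0
  else (unit_ball_volume R n / 2 ^+ n)%:E * diam X ^+ n.

Definition hausdorff_cover (delta : R) (X : set T) : set (set T)^nat :=
  [set U | (forall i, diam (U i) <= delta%:E) /\ X `<=` \bigcup_i U i].

Definition hausdorff_pre (delta : R) (X : set T) : \bar R :=
  ereal_inf [set \sum_(i <oo) hausdorff_gauge (U i)
            | U in hausdorff_cover delta X].

Definition hausdorff (X : set T) : \bar R :=
  ereal_sup [set hausdorff_pre delta X | delta in [set delta | (0 < delta)%R]].

Hypothesis d_ge0 : forall x y, (0 <= d x y)%R.

Lemma hausdorff_gauge_ge0 X : 0 <= hausdorff_gauge X.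
Proof.
rewrite /hausdorff_gauge; case: ifPn => // /set0P[x Xx].
rewrite mule_ge0//.
  by rewrite lee_fin mulr_ge0 ?invr_ge0 ?exprn_ge0// ltW// unit_ball_volume_gt0.
apply: expe_ge0; apply: (@le_trans _ _ (d x x)%:E); first by rewrite lee_fin.
by apply: ereal_sup_ubound; exists (x, x).
Qed.

Lemma hausdorff_gauge0 : hausdorff_gauge set0 = 0.
Proof. by rewrite /hausdorff_gauge eqxx. Qed.

Let g delta (X : set (discreteT T)) :=
  if diam X <= delta%:E then hausdorff_gauge X else +oo.

Let g_ge0 delta X : 0 <= g delta X.
Proof. by rewrite /g; case: ifP => // _; exact: hausdorff_gauge_ge0. Qed.

Let g0 delta : g delta set0 = 0.
Proof.
rewrite /g hausdorff_gauge0 /diam.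
by rewrite set0X image_set0 ereal_sup0 leNye.
Qed.

Let hausdorff_preE delta : hausdorff_pre delta = mu_ext (g delta).
Proof.
apply/funext => X; apply/eqP; rewrite eq_le; apply/andP; split.
  apply: le_ereal_inf_tmp => _ [U [_ XU] <-].
  have [dU|] := pselect (forall i, diam (U i) <= delta%:E).
    apply: ereal_inf_lbound; exists U => //.
    by apply: eq_eseriesr => i _; rewrite /g dU.
  move=> /existsNP[i /negP/negbTE dUi].
  by rewrite (eseries_pinfty _ _ (_ : g delta (U i) = +oo)) ?leey//
    ?/g ?dUi// => k _; rewrite -ltNye (lt_le_trans _ (g_ge0 delta (U k))).
apply: le_ereal_inf_tmp => _ [U [dU XU] <-].
apply: ereal_inf_lbound; exists U; first by split.
by apply: eq_eseriesr => i _; rewrite /g dU.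
Qed.

Lemma hausdorff0 : hausdorff set0 = 0.
Proof.
apply/eqP; rewrite eq_le; apply/andP; split.
  by apply: ge_ereal_sup => _ [e e0 <-]; rewrite hausdorff_preE mu_ext0.
apply: ereal_sup_ubound; exists 1%R => //=.
by rewrite hausdorff_preE mu_ext0.
Qed.

Lemma hausdorff_ge0 X : 0 <= hausdorff X.
Proof.
apply: (@le_trans _ _ (hausdorff_pre 1 X)).
  by rewrite hausdorff_preE mu_ext_ge0.
by apply: ereal_sup_ubound; exists 1%R => /=.
Qed.

Lemma le_hausdorff : {homo hausdorff : A B / A `<=` B >-> A <= B}.
Proof.
move=> A B AB; apply: ge_ereal_sup => _ [e e0 <-].
apply: (@le_trans _ _ (hausdorff_pre e B)).
  by rewrite hausdorff_preE; exact: le_mu_ext.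
by apply: ereal_sup_ubound; exists e.
Qed.

Lemma hausdorff_sigma_subadditive : sigma_subadditive hausdorff.
Proof.
move=> F; apply: ge_ereal_sup => _ [e e0 <-].
apply: (@le_trans _ _ (\sum_(i <oo) hausdorff_pre e (F i))).
  by rewrite hausdorff_preE; exact: mu_ext_sigma_subadditive.
apply: lee_nneseries => [i _ _|i _].
  by rewrite hausdorff_preE mu_ext_ge0.
by apply: ereal_sup_ubound; exists e.
Qed.

End hausdorff.

Section sphere.
Context {R : realType}.
Implicit Types n : nat.

(* The norm `|x| of 'rV[R]_n is the sup norm, hence the explicit formula. *)
Definition euclid_norm n (x : 'rV[R]_n) : R :=
  Num.sqrt (\sum_(i < n) x 0 i ^+ 2).

(* S^n, in R^(n+1) *)
Definition sphere n := {x : 'rV[R]_n.+1 | euclid_norm x == 1}.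

HB.instance Definition _ n := Choice.on (sphere n).

Lemma sphere_pole_subproof n :
  euclid_norm (delta_mx 0 0 : 'rV[R]_n.+1) == 1.
Proof.
rewrite /euclid_norm big_ord_recl big1 ?mxE//= ?expr1n ?addr0 ?sqrtr1//.
by move=> i _; rewrite mxE expr0n.
Qed.

HB.instance Definition _ n :=
  isPointed.Build (sphere n) (exist (fun x : 'rV[R]_n.+1 => euclid_norm x == 1) _
    (sphere_pole_subproof n)).

Definition dE n (x y : sphere n) : R := euclid_norm (val x - val y).

Lemma dE_ge0 n (x y : sphere n) : 0 <= dE x y.
Proof. exact: sqrtr_ge0. Qed.

Definition hausdorff_sphere n : set (sphere n) -> \bar R :=
  hausdorff (@dE n) n.

HB.instance Definition _ n :=
  isOuterMeasure.Build R (sphere n) (@hausdorff_sphere n)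
    (hausdorff0 n (@dE_ge0 n)) (hausdorff_ge0 n (@dE_ge0 n))
    (@le_hausdorff _ _ (@dE n) n (@dE_ge0 n))
    (hausdorff_sigma_subadditive n (@dE_ge0 n)).

Definition narea n : {outer_measure set (sphere n) -> \bar R} :=
  @hausdorff_sphere n.

(* The measurable sets of the surface measure are the Caratheodory-measurable
   ones: up to null sets, the Borel sets of the sphere. *)
Definition mu n : {measure set (caratheodory_type (narea n)) -> \bar R} :=
  narea n.

Definition heaviside (x : R) : R := if 0 < x then 1 else 0.

Definition St n (A : set (sphere n)) (l : R) : \bar R :=
  (\int[@mu n]_(x in A) \int[@mu n]_(y in A) (heaviside (l - dE x y))%:E)%E.

(* derive1 takes an arbitrary value where St is not differentiable; as a
   density st is only meaningful almost everywhere and carries the same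
   information as St. *)
Definition st n (A : set (sphere n)) : R -> R :=
  derive1 (fun l => fine (St A l)).

End sphere.
Arguments sphere : clear implicits.
Arguments narea : clear implicits.
Arguments mu : clear implicits.

(* Main.v *)
From HB Require Import structures.
Require Import Defs.
From mathcomp Require Import all_boot all_order all_algebra.
From mathcomp Require Import all_classical all_reals all_analysis.
From mathcomp Require Import measurable_realfun ring lra.

(** Write [B x l] for the open ball of centre [x] and radius [l] in the sphere, for
the Euclidean distance. Then [St A l] is the integral over [x] in [A] of the
area of [A `&` B x l]. All balls of radius [l] have the same area [c], because
the sphere is homogeneous; so the areas of the parts of [B x l] in [A] and in
its complement add up to [c]. Integrating over [A],

  [St A l = c * mu A - int_(x in A) mu (~` A `&` B x l)],

and likewise

  [St (~` A) l = c * mu (~` A) - int_(x in ~` A) mu (A `&` B x l)].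

The two subtracted terms are both equal to the measure of the pairs in
[A `*` ~` A] at distance less than [l], by Tonelli's theorem and the symmetry of
the distance. As the two areas agree, so do [St A] and [St (~` A)], and hence
their derivatives. This argument is [integral_xsection_halves]; it needs three
facts on the area, which is a Hausdorff measure.

- Balls of equal radius have equal area ([narea_sphere_ball]): isometries preserve
  Hausdorff measures, and the reflection in the hyperplane orthogonal to [x - y]
  exchanges the points [x] and [y] of the sphere.

- The area of the sphere is finite ([narea_setT_lty]), which is what makes the
  subtraction and Tonelli's theorem legitimate: the sphere is a finite union of
  Lipschitz graphs over pieces of R^n, and those have efficient covers by grids.

- The distance is measurable for the product of the Carathéodory
  sigma-algebra with itself ([measurable_dE]): the Hausdorff outer measure is
  additive on sets at positive distance from each other ([hausdorff_metric]), so
  the sublevel sets of Lipschitz functions, in particular of the coordinates, are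
  Carathéodory-measurable ([caratheodory_sublevel]). *)

Set Implicit Arguments.
Unset Strict Implicit.
Unset Printing Implicit Defensive.

Import Order.TTheory GRing.Theory Num.Theory.

Local Open Scope classical_set_scope.
Local Open Scope ring_scope.

(** * Hausdorff outer measures *)

Lemma diam_le (R : realType) (T : pointedType) (d : T -> T -> R) (U : set T)
    (r : \bar R) :
  (forall x y, U x -> U y -> ((d x y)%:E <= r)%E) -> (diam d U <= r)%E.
Proof.
by move=> h; apply: ge_ereal_sup => _ [[x y] /= [Ux Uy] <-]; exact: h.
Qed.

Lemma dist_le_diam (R : realType) (T : pointedType) (d : T -> T -> R)
    (U : set T) (x y : T) : U x -> U y -> ((d x y)%:E <= diam d U)%E.
Proof. by move=> Ux Uy; apply: ereal_sup_ubound; exists (x, y). Qed.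

(** The image under an isometry of a cover has the same diameters, hence the
same gauges. *)
Lemma hausdorff_isometry_le (R : realType) (T : pointedType)
    (d : T -> T -> R) (n : nat) (f : T -> T) (X : set T) :
  (forall x y, d (f x) (f y) = d x y) ->
  (hausdorff d n (f @` X) <= hausdorff d n X)%E.
Proof.
move=> fd.
have diam_img U : diam d (f @` U) = diam d U.
  congr ereal_sup; apply/seteqP.
  split => [_ [[_ _] /= [[x Ux <-] [y Uy <-]] <-]|].
    by exists (x, y) => /=; rewrite ?fd.
  move=> _ [[x y] /= [Ux Uy] <-]; exists (f x, f y) => //=; last by rewrite fd.
  by split; [exists x|exists y].
apply: ge_ereal_sup => _ [e e0 <-].
apply: (@le_trans _ _ (hausdorff_pre d n e X)); last first.
  by apply: ereal_sup_ubound; exists e.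
apply: le_ereal_inf_tmp => _ [U [dU XU] <-].
apply: ereal_inf_lbound; exists (fun i => f @` U i).
  split; first by move=> i; rewrite diam_img.
  by rewrite -image_bigcup; exact: image_subset.
apply: eq_eseriesr => i _.
rewrite /hausdorff_gauge diam_img.
by have -> : (f @` U i == set0) = (U i == set0) by
  apply/eqP/eqP => [/image_set0_set0 //|->]; rewrite image_set0.
Qed.

(** A set of diameter less than [e] cannot meet both [X] and [Y], so a fine
cover of the union separates into a cover of [X] and a cover of [Y] whose total
gauge is no larger. *)
Lemma hausdorff_metric (R : realType) (T : pointedType) (d : T -> T -> R)
    (n : nat) (d_ge0 : forall x y, 0 <= d x y) (e : R) (X Y : set T) :
  0 < e -> (forall x y, X x -> Y y -> e <= d x y) ->
  (hausdorff d n X + hausdorff d n Y <= hausdorff d n (X `|` Y))%E.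
Proof.
move=> e0 XYe.
have pre_mono a b Z : a <= b ->
    (hausdorff_pre d n b Z <= hausdorff_pre d n a Z)%E.
  move=> ab; apply: ereal_inf_le_tmp => _ [U [dU ZU] <-]; exists U => //.
  by split => // i; rewrite (le_trans (dU i))// lee_fin.
have pre_ge0 a Z : (0 <= hausdorff_pre d n a Z)%E.
  apply: le_ereal_inf_tmp => _ [U _ <-].
  by apply: nneseries_ge0 => i _ _; exact: hausdorff_gauge_ge0.
have pre_sep a : a < e -> (hausdorff_pre d n a X + hausdorff_pre d n a Y <=
    hausdorff_pre d n a (X `|` Y))%E.
  move=> ae; apply: le_ereal_inf_tmp => _ [U [dU XYU] <-].
  (* the part of the cover that is used for Z *)
  pose tr (Z : set T) i := if U i `&` Z == set0 then set0 else U i.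
  have trs Z i : tr Z i `<=` U i by rewrite /tr; case: ifP => _ x.
  have tr_cover Z : Z `<=` X `|` Y -> hausdorff_cover d a Z (tr Z).
    move=> ZXY; split => [i|x Zx].
      by apply: diam_le => x y /trs Ux /trs Uy; rewrite (le_trans _ (dU i))//
        dist_le_diam.
    have [i _ Uix] := XYU _ (ZXY _ Zx); exists i => //.
    by rewrite /tr; case: ifPn => // /eqP UZ; rewrite -UZ.
  have gauge_tr i : (hausdorff_gauge d n (tr X i) + hausdorff_gauge d n (tr Y i)
      <= hausdorff_gauge d n (U i))%E.
    have g0 := hausdorff_gauge_ge0 n d_ge0.
    rewrite /tr; case: ifPn => [_|/set0P[x [Ux Xx]]].
      by case: ifPn => _; rewrite hausdorff_gauge0 add0e.
    case: ifPn => [_|/set0P[y [Uy Yy]]].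
      by rewrite hausdorff_gauge0 adde0.
    have := le_trans (dist_le_diam d Ux Uy) (dU i).
    by rewrite lee_fin leNgt (lt_le_trans ae (XYe _ _ Xx Yy)).
  apply: (@le_trans _ _ (\sum_(i <oo) (hausdorff_gauge d n (tr X i) +
      hausdorff_gauge d n (tr Y i)))%E).
    rewrite nneseriesD; [|by move=> *; exact: hausdorff_gauge_ge0..].
    apply: leeD; apply: ereal_inf_lbound.
      by exists (tr X) => //; apply: tr_cover; exact: subsetUl.
    by exists (tr Y) => //; apply: tr_cover; exact: subsetUr.
  by apply: lee_nneseries => // i _ _; rewrite adde_ge0// hausdorff_gauge_ge0.
have pre_le a b : 0 < a -> 0 < b ->
    (hausdorff_pre d n a X + hausdorff_pre d n b Y <=
     hausdorff d n (X `|` Y))%E.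
  (* smaller mesh means larger pre-measure, so one common mesh suffices *)
  move=> a0 b0; pose c := Num.min (Num.min a b) (e / 2).
  have c0 : 0 < c by rewrite !lt_min a0 b0 divr_gt0.
  have ca : c <= a by rewrite !ge_min lexx.
  have cb : c <= b by rewrite !ge_min lexx orbT.
  have ce : c < e by rewrite gt_min ltr_pdivrMr// ltr_pMr// ltr1n orbT.
  apply: (@le_trans _ _ (hausdorff_pre d n c (X `|` Y))).
    by apply: le_trans (pre_sep _ ce); rewrite leeD// pre_mono.
  by apply: ereal_sup_ubound; exists c.
have [->|] := eqVneq (hausdorff d n (X `|` Y)) +oo%E; first by rewrite leey.
rewrite -ltey => XYoo.
have pre_fin b : 0 < b -> hausdorff_pre d n b Y \is a fin_num.
  move=> b0; rewrite ge0_fin_numE// (le_lt_trans _ XYoo)//.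
  by apply: le_trans (pre_le _ _ b0 b0); rewrite leeDr.
have HX b : 0 < b ->
    (hausdorff d n X + hausdorff_pre d n b Y <= hausdorff d n (X `|` Y))%E.
  move=> b0; rewrite -leeBrDr ?pre_fin//.
  apply: ge_ereal_sup => _ [a a0 <-].
  by rewrite leeBrDr ?pre_fin// pre_le.
have Xfin : hausdorff d n X \is a fin_num.
  rewrite ge0_fin_numE ?hausdorff_ge0// (le_lt_trans _ XYoo)//.
  by apply: le_trans (HX 1 ltr01); rewrite leeDl.
rewrite -leeBrDl//; apply: ge_ereal_sup => _ [b b0 <-].
by rewrite leeBrDl// HX.
Qed.

(** * Measurability of sublevel sets *)

(** Carathéodory's criterion: additivity is known only for two pieces of a set
separated by a gap in the values of [g], whereas [g < l] and [l <= g] touch. Fix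
a test set [X] of finite measure, take [s k] increasing to [l], and let [f k] be
the measure of the part of [X] where [g < s k]. As [f k] plus the measure of the
part where [l <= g] is at most [m X], it is enough that the part where [g < l]
has measure at most the supremum [L] of [f]. The gap between the levels [s k]
and [s k.+1] gives [m (ring k.+1) <= f k.+2 - f k]; these bounds telescope, so
the rings that cover [s j.+1 <= g < l] have total measure at most
[2 * L - f j.+1 - f j]. Adding [f j.+1], the part where [g < l] has measure at
most [2 * L - f j] for all [j], hence at most [L]. *)
Lemma caratheodory_sublevel (R : realType) (T : Type)
    (m : {outer_measure set T -> \bar R}) (g : T -> R) (l : R) :
  (forall s t X, s < t ->
    (m (X `&` [set x | (g x < s)%R]) + m (X `&` [set x | (t <= g x)%R]) <=
      m X)%E) ->
  m.-caratheodory [set x | g x < l].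
Proof.
move=> msep; apply: le_caratheodory_measurable => X.
have [->|] := eqVneq (m X) +oo%E; first by rewrite leey.
rewrite -ltey => mXoo.
have mfin Y : Y `<=` X -> m Y \is a fin_num.
  move=> YX; rewrite ge0_fin_numE ?outer_measure_ge0//.
  by rewrite (le_lt_trans _ mXoo)// le_outer_measure.
pose s k : R := l - k.+1%:R^-1.
have s_incr i j : (i < j)%N -> s i < s j.
  by move=> ij; rewrite ltrD2l ltrN2 ltf_pV2 ?posrE// ltr_nat.
have s_lt k : s k < l by rewrite gtrBl invr_gt0.
pose low t := X `&` [set x | g x < t].
have lowX t : low t `<=` X by exact: subIsetl.
pose ring k := X `&` [set x | s k <= g x < s k.+1].
have mfinI Y : m (X `&` Y) \is a fin_num by apply: mfin; exact: subIsetl.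
pose f k := fine (m (low (s k))).
have fE k : (f k)%:E = m (low (s k)) by exact: fineK (mfinI _).
pose B := fine (m X) - fine (m (X `&` ~` [set x | g x < l])).
have fB k : f k <= B.
  have := msep _ _ X (s_lt k).
  rewrite lerBrDr -lee_fin EFinD fE !fineK ?mfin//.
  apply: le_trans; rewrite leeD2l// le_outer_measure//.
  by apply: setIS => x /= /negP; rewrite -leNgt.
have supf : has_sup (range f).
  by split; [exists (f 0), 0|exists B => _ [k _ <-]].
pose L := sup (range f).
have fL k : f k <= L by apply: sup_upper_bound => //; exists k.
have ringf k : (m (ring k.+1) <= (f k.+2 - f k)%:E)%E.
  rewrite EFinB leeBrDl// !fE.
  apply: le_trans (msep _ _ (low (s k.+2)) (s_incr _ _ (ltnSn k))).
  apply: leeD; apply: le_outer_measure => x /=.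
    move=> [Xx /= gx]; split => //; split => //=.
    by rewrite (lt_trans gx)// s_incr.
  by move=> [Xx /= /andP[gx1 gx2]].
have rings j N : (\sum_(j <= k < (j + N)%N) m (ring k.+1) <=
    (f (j + N)%N.+1 + f (j + N)%N - f j.+1 - f j)%:E)%E.
  elim: N => [|N ih].
    by rewrite addn0 big_geq// lee_fin; lra.
  rewrite addnS big_nat_recr ?leq_addr//=.
  apply: le_trans (leeD ih (ringf _)) _; rewrite -EFinD lee_fin; lra.
have tail j : (\sum_(j <= k <oo) m (ring k.+1) <= (2 * L - f j.+1 - f j)%:E)%E.
  apply: lime_le.
    by apply: is_cvg_nneseries => *; exact: outer_measure_ge0.
  near=> N; have jN : (j <= N)%N by near: N; exact: nbhs_infty_ge.
  rewrite -(subnKC jN); apply: le_trans (rings _ _) _.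
  rewrite lee_fin; have := fL (j + (N - j))%N.+1.
  by have := fL (j + (N - j))%N; lra.
have low_cover j : low l `<=`
    low (s j.+1) `|` \bigcup_(k in ~` `I_j) ring k.+1.
  move=> x [Xx /= gx].
  have [k sk] : exists k, g x < s k.
    have [k] := ltr_add_invr gx.
    by exists k; rewrite ltrBrDr.
  have ex : exists k, g x < s k by exists k.
  case: (ex_minnP ex) => i si imin.
  have [ij|ji] := leqP i j.+1.
    left; split => //=; move: ij; rewrite leq_eqVlt => /predU1P[<-//|/s_incr].
    exact: lt_trans.
  case: i si imin ji => [//|[//|i]] si imin ji; right; exists i => /=.
    by apply/negP; rewrite -leqNgt.
  split => //=; rewrite si andbT leNgt; apply/negP => /imin.
  by rewrite ltnn.
have lowL j : fine (m (low l)) <= 2 * L - f j.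
  rewrite -lee_fin fineK ?mfin//.
  apply: le_trans (le_outer_measure m _ _ (low_cover j)) _.
  apply: le_trans (outer_measureU2 _ _ _) _.
  rewrite -fE.
  apply: le_trans (leeD2l _ (outer_measure_sigma_subadditive_tail _ _ _)) _.
  by apply: le_trans (leeD2l _ (tail j)) _; rewrite -EFinD lee_fin; lra.
have LB : L <= B by apply: ge_sup; [exact: supf.1|move=> _ [k _ <-]].
have L2 : L <= 2 * L - fine (m (low l)).
  apply: ge_sup; first exact: supf.1.
  by move=> _ [k _ <-]; have := lowL k; lra.
have : fine (m (low l)) <= B by lra.
by rewrite lerBrDr -lee_fin EFinD !fineK ?mfin.
Unshelve. all: by end_near. Qed.

(** * Homogeneity of the sphere *)

Definition dot (R : realType) n (x y : 'rV[R]_n) : R :=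
  \sum_(i < n) x 0 i * y 0 i.

Lemma dotC (R : realType) n (x y : 'rV[R]_n) : dot x y = dot y x.
Proof. by apply: eq_bigr => i _; rewrite mulrC. Qed.

Lemma dotBZl (R : realType) n (c : R) (x v y : 'rV[R]_n) :
  dot (x - c *: v) y = dot x y - c * dot v y.
Proof.
rewrite /dot mulr_sumr -sumrB; apply: eq_bigr => i _.
by rewrite !mxE mulrBl mulrA.
Qed.

Lemma dotBl (R : realType) n (x v y : 'rV[R]_n) :
  dot (x - v) y = dot x y - dot v y.
Proof. by have := dotBZl 1 x v y; rewrite scale1r mul1r. Qed.

Lemma dot_eq0 (R : realType) n (x : 'rV[R]_n) : dot x x = 0 -> x = 0.
Proof.
move=> /eqP; rewrite psumr_eq0 => [/allP x0|i _]; last first.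
  by rewrite -expr2 sqr_ge0.
apply/rowP => i; rewrite mxE; apply/eqP.
by have := x0 i (mem_index_enum i); rewrite /= mulf_eq0 orbb.
Qed.

Lemma euclid_normE (R : realType) n (x : 'rV[R]_n) :
  euclid_norm x = Num.sqrt (dot x x).
Proof. by congr Num.sqrt; apply: eq_bigr => i _; rewrite expr2. Qed.

Lemma sphere_dot (R : realType) n (x : sphere R n) : dot (val x) (val x) = 1.
Proof.
have := valP x; rewrite euclid_normE => /eqP /(congr1 (fun t => t ^+ 2)).
by rewrite expr1n sqr_sqrtr// sumr_ge0// => i _; rewrite -expr2 sqr_ge0.
Qed.

Definition reflection (R : realType) n (v x : 'rV[R]_n) : 'rV[R]_n :=
  x - (2 * dot x v / dot v v) *: v.

(** The degenerate vector [v = 0] is harmless here and below: since [0^-1 = 0],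
its reflection is the identity. *)
Lemma dot_reflection (R : realType) n (v x : 'rV[R]_n) :
  dot (reflection v x) (reflection v x) = dot x x.
Proof.
rewrite /reflection; set c := _ / _.
rewrite dotBZl (dotC x) (dotC v) !dotBZl (dotC v x) {}/c.
by have [->|v0] := eqVneq (dot v v) 0; [rewrite invr0; ring|field].
Qed.

Lemma reflectionB (R : realType) n (v x y : 'rV[R]_n) :
  reflection v (x - y) = reflection v x - reflection v y.
Proof.
rewrite /reflection dotBl.
by apply/rowP => i; rewrite !mxE; ring.
Qed.

Lemma reflectionK (R : realType) n (v : 'rV[R]_n) : involutive (reflection v).
Proof.
move=> x; rewrite {1}/reflection dotBZl.
have [v0|v0] := eqVneq (dot v v) 0.
  by rewrite /reflection v0 invr0 !mulr0 !scale0r !subr0.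
have -> : 2 * (dot x v - 2 * dot x v / dot v v * dot v v) / dot v v =
    - (2 * dot x v / dot v v) by field.
by rewrite /reflection scaleNr opprK subrK.
Qed.

Lemma reflection_swap (R : realType) n (x y : 'rV[R]_n) :
  dot x x = dot y y -> reflection (x - y) x = y.
Proof.
move=> xy; have [/dot_eq0 /subr0_eq <-|v0] := eqVneq (dot (x - y) (x - y)) 0.
  by rewrite /reflection subrr scaler0 subr0.
have vv : dot (x - y) (x - y) = 2 * dot x (x - y).
  by rewrite (dotC x) !dotBl ![dot _ (x - y)]dotC !dotBl (dotC y x) -xy; ring.
by rewrite /reflection -vv divff// scale1r opprB addrC subrK.
Qed.

Lemma sphere_reflection_subproof (R : realType) n (v : 'rV[R]_n.+1)
  (x : sphere R n) : euclid_norm (reflection v (val x)) == 1.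
Proof. by rewrite euclid_normE dot_reflection sphere_dot sqrtr1. Qed.

Definition sphere_reflection (R : realType) n (v : 'rV[R]_n.+1)
    (x : sphere R n) : sphere R n :=
  exist (fun z : 'rV[R]_n.+1 => euclid_norm z == 1) _
    (sphere_reflection_subproof v x).

Lemma dE_reflection (R : realType) n (v : 'rV[R]_n.+1) (x y : sphere R n) :
  dE (sphere_reflection v x) (sphere_reflection v y) = dE x y.
Proof. by rewrite /dE/= -reflectionB !euclid_normE dot_reflection. Qed.

Definition sphere_ball (R : realType) n (x : sphere R n) (l : R) :
    set (sphere R n) :=
  [set y | dE x y < l].

(** The reflection that exchanges the two centres exchanges the two balls. *)
Lemma narea_sphere_ball (R : realType) n (x y : sphere R n) (l : R) :
  narea R n (sphere_ball x l) = narea R n (sphere_ball y l).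
Proof.
suff le z w : (narea R n (sphere_ball z l) <= narea R n (sphere_ball w l))%E.
  by apply/eqP; rewrite eq_le !le.
pose f := sphere_reflection (val z - val w).
have fz : f z = w.
  by apply: val_inj; apply: reflection_swap; rewrite !sphere_dot.
have fK : involutive f by move=> t; apply: val_inj; exact: reflectionK.
have -> : sphere_ball z l = f @` sphere_ball w l.
  apply/seteqP; split => [t /= zt|_ [t /= wt <-]].
    by exists (f t) => //; rewrite /sphere_ball/= -fz dE_reflection.
  by rewrite /sphere_ball/= -[z]fK fz dE_reflection.
by apply: hausdorff_isometry_le; exact: dE_reflection.
Qed.

(** * Finiteness of the area of the sphere *)

Lemma dE_le_sum (R : realType) n (x y : sphere R n) :
  dE x y <= \sum_(i < n.+1) `|val x 0 i - val y 0 i|.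
Proof.
have sum_sqr_le (I : finType) (a : I -> R) : (forall i, 0 <= a i) ->
    \sum_i a i ^+ 2 <= (\sum_i a i) ^+ 2.
  move=> a0; rewrite [leRHS]expr2 mulr_suml ler_sum// => i _.
  by rewrite expr2 ler_wpM2l// (bigD1 i)//= lerDl sumr_ge0.
rewrite -[leRHS]ger0_norm ?sumr_ge0// -sqrtr_sqr ler_wsqrtr//.
apply: le_trans (sum_sqr_le _ _ _) => //.
by apply: ler_sum => i _; rewrite !mxE real_normK// num_real.
Qed.

Lemma hausdorff_pre_finite_cover (R : realType) (T : pointedType)
    (d : T -> T -> R) (n : nat) (I : finType) (U : I -> set T) (r e : R)
    (X : set T) :
  (forall x y, 0 <= d x y) -> 0 <= r -> r <= e ->
  (forall i x y, U i x -> U i y -> d x y <= r) -> X `<=` \bigcup_i U i ->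
  (hausdorff_pre d n e X <=
    (#|I|%:R * (unit_ball_volume R n / 2 ^+ n * r ^+ n))%:E)%E.
Proof.
move=> d_ge0 r0 re dU XU; set c := unit_ball_volume R n / 2 ^+ n.
have c0 : 0 <= c.
  by rewrite divr_ge0 ?exprn_ge0// ltW// unit_ball_volume_gt0.
pose V k := nth set0 [seq U i | i <- enum I] k.
have VE k : (k < #|I|)%N -> exists i, V k = U i.
  rewrite cardE => kI; have [x _] : exists x, x \in enum I.
    by case: (enum I) kI => // x s _; exists x; rewrite mem_head.
  by exists (nth x (enum I) k); rewrite /V (nth_map x).
have V0 k : (#|I| <= k)%N -> V k = set0.
  by rewrite cardE => Ik; rewrite /V nth_default// size_map.
have dV k x y : V k x -> V k y -> d x y <= r.
  by have [/VE[i ->]|/V0 ->//] := ltnP k #|I|; exact: dU.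
apply: (@le_trans _ _ (\sum_(k <oo) hausdorff_gauge d n (V k))%E).
  apply: ereal_inf_lbound; exists V => //; split => [k|x /XU[i _ Ux]].
    apply: (@le_trans _ _ r%:E); last by rewrite lee_fin.
    by apply: diam_le => x y Vx Vy; rewrite lee_fin; exact: dV Vx Vy.
  exists (index i (enum I)) => //.
  by rewrite /V (nth_map i) ?index_mem ?mem_enum// nth_index ?mem_enum.
have gV k : (hausdorff_gauge d n (V k) <= (c * r ^+ n)%:E)%E.
  rewrite /hausdorff_gauge; case: ifPn => [_|/set0P[x Vx]].
    by rewrite lee_fin mulr_ge0// exprn_ge0.
  have d0 : (0 <= diam d (V k))%E.
    by apply: le_trans (dist_le_diam d Vx Vx); rewrite lee_fin.
  have dr : (diam d (V k) <= r%:E)%E.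
    by apply: diam_le => a b Va Vb; rewrite lee_fin; exact: dV Va Vb.
  have dfin : diam d (V k) \is a fin_num.
    by rewrite ge0_fin_numE// (le_lt_trans dr)// ltry.
  rewrite -(fineK dfin) -EFin_expe -EFinM lee_fin ler_wpM2l//.
  by rewrite lerXn2r ?nnegrE ?fine_ge0// -lee_fin fineK.
rewrite (nneseries_split 0 #|I|); last first.
  by move=> k _; exact: hausdorff_gauge_ge0.
rewrite add0n (@eseries0 _ _ #|I|) ?adde0; last first.
  by move=> k Ik _; rewrite V0// hausdorff_gauge0.
apply: (@le_trans _ _ (\sum_(0 <= k < #|I|) (c * r ^+ n)%:E)%E).
  by apply: lee_sum.
by rewrite (sumEFin _ _ (fun=> c * r ^+ n)) sumr_const_nat subn0 mulr_natl.
Qed.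

Lemma sphere_coord_le1 (R : realType) n (x : sphere R n) i :
  `|val x 0 i| <= 1.
Proof.
rewrite -(@expr_le1 _ 2)// real_normK ?num_real//.
apply: (@le_trans _ _ (dot (val x) (val x))); last by rewrite sphere_dot.
rewrite /dot (bigD1 i)//= expr2 lerDl sumr_ge0// => j _.
by rewrite -expr2 sqr_ge0.
Qed.

(** Otherwise the squares of the [n.+1] coordinates would all be less than
[1 / n.+1], whereas their sum is 1. *)
Lemma sphere_large_coord (R : realType) n (x : sphere R n) :
  exists i, 1 <= n.+1%:R * `|val x 0 i|.
Proof.
apply: contrapT => /forallNP small.
have small2 i : val x 0 i * val x 0 i < n.+1%:R^-1.
  apply: (@le_lt_trans _ _ `|val x 0 i|).
    rewrite -expr2 -real_normK ?num_real// expr2 ler_piMl//.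
    exact: sphere_coord_le1.
  by have /negP := small i; rewrite -ltNge mulrC -ltr_pdivlMr// div1r.
have := sphere_dot x; apply/eqP; rewrite lt_eqF//.
apply: (@lt_le_trans _ _ (\sum_(i < n.+1) n.+1%:R^-1)).
  apply: ltr_sum => [|i _]; last exact: small2.
  by apply/hasP; exists ord0; rewrite ?mem_index_enum.
by rewrite sumr_const card_ord -[_ *+ _]mulr_natl mulfV.
Qed.

(** Where the coordinate [i] has a fixed sign and is at least [1 / n.+1] in
absolute value, the sphere is a Lipschitz graph over the other [n] coordinates:
[x_i ^+ 2] is a Lipschitz function of them, and dividing the difference of the
squares by [x_i + y_i], which is at least [2 / n.+1] in absolute value, bounds
the difference of the [i]-th coordinates. *)
Lemma sphere_cell_dist (R : realType) n (r s : R) (i : 'I_n.+1)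
    (x y : sphere R n) : 0 <= r -> s ^+ 2 = 1 ->
  1 <= n.+1%:R * (s * val x 0 i) -> 1 <= n.+1%:R * (s * val y 0 i) ->
  (forall j, j != i -> `|val x 0 j - val y 0 j| <= r) ->
  dE x y <= 2 * n.+1%:R ^+ 2 * r.
Proof.
move=> r0 s1 xi yi xyr.
have N1 : 1 <= n.+1%:R :> R by rewrite ler1n.
have sumr_le (F : 'I_n.+1 -> R) b : 0 <= b -> (forall j, j != i -> F j <= b) ->
    \sum_(j | j != i) F j <= n.+1%:R * b.
  move=> b0 Fb; apply: (@le_trans _ _ (\sum_(j | j != i) b)).
    exact: ler_sum.
  rewrite sumr_const -[leLHS]mulr_natl ler_wpM2r// ler_nat.
  by apply: leq_trans (max_card _) _; rewrite card_ord.
have sqr_diff : `|val x 0 i ^+ 2 - val y 0 i ^+ 2| <= n.+1%:R * (2 * r).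
  have -> : val x 0 i ^+ 2 - val y 0 i ^+ 2 =
      \sum_(j | j != i) (val y 0 j ^+ 2 - val x 0 j ^+ 2).
    have := sphere_dot x; have := sphere_dot y.
    rewrite /dot (bigD1 i)//= [X in _ -> X = _ -> _](bigD1 i)//= sumrB.
    under eq_bigr do rewrite -expr2.
    under [X in _ -> _ + X = _ -> _]eq_bigr do rewrite -expr2.
    by rewrite -!expr2; lra.
  apply: le_trans (ler_norm_sum _ _ _) _; apply: sumr_le => [|j ji].
    by rewrite mulr_ge0.
  rewrite subr_sqr normrM mulrC distrC ler_pM// ?xyr//.
  apply: le_trans (ler_normD _ _) _.
  by have := sphere_coord_le1 x j; have := sphere_coord_le1 y j; lra.
have xyi : `|val x 0 i - val y 0 i| <= n.+1%:R ^+ 2 * r.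
  have sum_ge : 2 <= n.+1%:R * `|val x 0 i + val y 0 i|.
    have sn : `|s| = 1.
      by apply/eqP; rewrite -(@eqrXn2 _ 2)// real_normK ?num_real// s1 expr1n.
    have -> : `|val x 0 i + val y 0 i| = `|s * (val x 0 i + val y 0 i)|.
      by rewrite normrM sn mul1r.
    apply: (@le_trans _ _ (n.+1%:R * (s * (val x 0 i + val y 0 i)))); first lra.
    by rewrite ler_wpM2l// ler_norm.
  have : 2 * `|val x 0 i - val y 0 i| <= n.+1%:R * (n.+1%:R * (2 * r)).
    apply: (@le_trans _ _ (n.+1%:R * `|val x 0 i ^+ 2 - val y 0 i ^+ 2|)).
      by rewrite subr_sqr normrM [X in _ <= _ * X]mulrC mulrA ler_wpM2r.
    by rewrite ler_wpM2l.
  by rewrite expr2; lra.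
apply: le_trans (dE_le_sum x y) _; rewrite (bigD1 i)//=.
have := sumr_le (fun j => `|val x 0 j - val y 0 j|) r r0 xyr.
have : n.+1%:R * r <= n.+1%:R ^+ 2 * r by rewrite ler_wpM2r// expr2 ler_peMl.
lra.
Qed.

(** Cut the sphere into [2 * n.+1] graphs, according to a large coordinate and its
sign, and cut the cube [-1, 1]^n below each graph into a grid of step [1 / k].
At most [(3 * k) ^ n] cells per graph, each of diameter at most [D / k], make a
total gauge that does not depend on [k]. *)
Lemma narea_setT_lty (R : realType) n : (narea R n setT < +oo)%E.
Proof.
pose D : R := 4 * n.+1%:R ^+ 2.
pose C : R := (#|{: 'I_n.+1 * bool}| * 3 ^ n)%:R *
   (unit_ball_volume R n / 2 ^+ n * D ^+ n).
suff : (narea R n setT <= C%:E)%E by move=> /le_lt_trans; apply; rewrite ltry.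
apply: ge_ereal_sup => _ [e /= e0 <-].
pose k := (Num.truncn (D / e)).+1.
have D0 : 0 < D by rewrite mulr_gt0// exprn_gt0.
have k0 : 0 < k%:R :> R by rewrite ltr0n.
have ke : D / k%:R <= e.
  rewrite ler_pdivrMr// mulrC -ler_pdivrMr// ltW// truncnS_gt//.
(* [k * (t + 1)] ranges over [0, 2 * k] for t in [-1, 1], so its integer part is
   less than [3 * k] as k > 0 *)
pose I : finType := (('I_n.+1 * bool) * {ffun 'I_n -> 'I_(3 * k)})%type.
pose U (q : I) : set (sphere R n) := [set x : sphere R n |
  1 <= n.+1%:R * ((-1) ^+ q.1.2 * val x 0 q.1.1) /\
  forall j, `|k%:R * (val x 0 (lift q.1.1 j) + 1) - (q.2 j)%:R| <= 1].
have UD q x y : U q x -> U q y -> dE x y <= D / k%:R.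
  move=> [x1 xj] [y1 yj].
  have -> : D / k%:R = 2 * n.+1%:R ^+ 2 * (2 / k%:R).
    by rewrite mulrA [2 * _ * 2]mulrAC -natrM.
  apply: (sphere_cell_dist _ _ x1 y1).
  - by rewrite divr_ge0// ltW.
  - exact: sqrr_sign.
  move=> j; case: (unliftP q.1.1 j) => [h ->|->]; last by rewrite eqxx.
  move=> _; rewrite ler_pdivlMr// -{1}(gtr0_norm k0) -normrM.
  have := xj h; have := yj h; rewrite !ler_norml; lra.
have coord1 (x : sphere R n) i : -1 <= val x 0 i <= 1.
  by rewrite -ler_norml sphere_coord_le1.
have Ucover : [set: sphere R n] `<=` \bigcup_q U q.
  move=> x _.
  have [i xi] : exists i, 1 <= n.+1%:R * `|val x 0 i|.
    exact: sphere_large_coord.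
  pose t (j : 'I_n) : R := k%:R * (val x 0 (lift i j) + 1).
  have t_ge0 j : 0 <= t j.
    by rewrite mulr_ge0//; have := coord1 x (lift i j); lra.
  have tr j : (Num.truncn (t j) < 3 * k)%N.
    rewrite truncn_lt_nat// natrM [ltRHS]mulrC ltr_pM2l//.
    by have := coord1 x (lift i j); lra.
  exists ((i, val x 0 i < 0), [ffun j => Ordinal (tr j)]) => //; split => /=.
    by rewrite -normrEsign.
  move=> j; rewrite ffunE /= -/(t j) ler_norml.
  by have /andP[] := truncn_itv (t_ge0 j); rewrite -natr1; lra.
have r0 : 0 <= D / k%:R by rewrite divr_ge0// ltW.
apply: le_trans (hausdorff_pre_finite_cover n (@dE_ge0 R n) r0 ke UD Ucover) _.
rewrite lee_fin card_prod card_ffun !card_ord /C.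
rewrite expr_div_n expnMn !natrM !natrX.
rewrite le_eqVlt; apply/orP; left; apply/eqP.
by field; rewrite !expf_neq0// gt_eqF.
Qed.

(** * Measurability of the distance *)

Lemma coord_le_dE (R : realType) n (x y : sphere R n) i :
  `|val x 0 i - val y 0 i| <= dE x y.
Proof.
rewrite /dE /euclid_norm -sqrtr_sqr ler_wsqrtr// (bigD1 i)//= !mxE lerDl.
by apply: sumr_ge0 => j _; rewrite sqr_ge0.
Qed.

Lemma dE_sym (R : realType) n (x y : sphere R n) : dE x y = dE y x.
Proof.
by congr Num.sqrt; apply: eq_bigr => i _; rewrite !mxE -sqrrN opprB.
Qed.

(** A coordinate is 1-Lipschitz, so a gap in its values is a gap in distance and
[hausdorff_metric] applies. *)
Lemma measurable_coord (R : realType) n (i : 'I_n.+1) :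
  measurable_fun setT
    (fun x : caratheodory_type (narea R n) => val (x : sphere R n) 0 i).
Proof.
move=> _; apply: (measurability _ (RGenInftyO.measurableE R)) => //=.
move=> _ [_ [l ->] <-]; rewrite setTI.
rewrite (_ : _ @^-1` _ = [set x : sphere R n | val x 0 i < l]); last first.
  by apply/seteqP; split => x /=; rewrite in_itv.
apply: (caratheodory_sublevel (m := narea R n)) => s t X st.
apply: le_trans (@hausdorff_metric _ _ _ n (@dE_ge0 R n) (t - s) _ _ _ _) _.
- by rewrite subr_gt0.
- move=> x y [_ /= xs] [_ /= ty]; apply: le_trans (coord_le_dE x y i).
  by rewrite distrC; apply: le_trans (ler_norm _); lra.
- by rewrite -setIUr; apply: le_hausdorff; [exact: dE_ge0|exact: subIsetl].
Qed.

Lemma measurable_dE (R : realType) n :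
  measurable_fun setT (fun p : caratheodory_type (narea R n) *
    caratheodory_type (narea R n) => dE (p.1 : sphere R n) p.2).
Proof.
apply: (measurableT_comp (f := @Num.sqrt R)).
  by apply: continuous_measurable_fun; exact: sqrt_continuous.
apply: measurable_sum => i; apply: measurable_funX.
rewrite (_ : (fun x => _) = (fun p : caratheodory_type (narea R n) *
    caratheodory_type (narea R n) =>
    val (p.1 : sphere R n) 0 i - val (p.2 : sphere R n) 0 i)); last first.
  by apply/funext => p; rewrite !mxE.
by apply: measurable_funB; apply: measurableT_comp (measurable_coord i) _.
Qed.

(** * Halves of a finite measure space with a symmetric relation *)

(** Both sides are the product measure of the part of [E] in [A `*` B]. *)
Lemma integral_xsection_swap d (T : measurableType d) (R : realType)
    (m : {finite_measure set T -> \bar R}) (E : set (T * T)) (A B : set T) :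
  measurable E -> (forall x y, E (x, y) -> E (y, x)) ->
  measurable A -> measurable B ->
  (\int[m]_(x in A) m (B `&` xsection E x) =
   \int[m]_(x in B) m (A `&` xsection E x))%E.
Proof.
move=> mE symE mA mB.
have mEAB : measurable (E `&` A `*` B).
  by apply: measurableI => //; exact: measurableX.
have := indic_fubini_tonelli m m mEAB.
rewrite indic_fubini_tonelli_FE// indic_fubini_tonelli_GE// => H.
rewrite integral_mkcond [RHS]integral_mkcond.
transitivity (\int[m]_x (m \o xsection (E `&` A `*` B)) x)%E; last rewrite H.
  apply: eq_integral => x _; rewrite patchE /=; case: ifPn => xA.
    congr (m _); apply/seteqP; split => y; rewrite /xsection/= !inE.
      by move: xA; rewrite inE /= => xA [By Exy].
    by move=> [? [_ ?]].
  rewrite [xsection _ _](_ : _ = set0) ?measure0//.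
  by apply/seteqP; split => y //; rewrite /xsection/= inE => -[_ [/mem_set]];
    rewrite (negbTE xA).
apply: eq_integral => y _; rewrite patchE /=; case: ifPn => yB.
  congr (m _); apply/seteqP; split => x; rewrite /ysection/xsection/= !inE.
    by move=> [/symE Exy [Ax _]].
  by move: yB; rewrite inE /= => yB [Ax /symE Exy].
rewrite [ysection _ _](_ : _ = set0) ?measure0//.
by apply/seteqP; split => x //; rewrite /ysection/= inE => -[_ [_ /mem_set]];
  rewrite (negbTE yB).
Qed.

(** The measure-theoretic core of the theorem, with [E] a symmetric relation such
as being at distance less than [l]. Splitting the sections of [E] along [A]
gives, for [B = A] and for [B = ~` A],
[int_B m (A `&` E_x) + int_B m (~` A `&` E_x) = c * m B]. The right-hand sides
agree for the two choices of [B], and so do the mixed terms, by symmetry of [E];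
what remains is the claim. Finiteness of [m] allows the subtraction. *)
Lemma integral_xsection_halves d (T : measurableType d) (R : realType)
    (m : {finite_measure set T -> \bar R}) (E : set (T * T)) (c : \bar R)
    (A : set T) :
  measurable E -> (forall x y, E (x, y) -> E (y, x)) ->
  (forall x, m (xsection E x) = c) ->
  measurable A -> m A = m (~` A) ->
  (\int[m]_(x in A) m (A `&` xsection E x) =
   \int[m]_(x in ~` A) m (~` A `&` xsection E x))%E.
Proof.
move=> mE symE mc mA mAAc.
have mAc : measurable (~` A) by exact: measurableC.
have mf (B : set T) : measurable B ->
    measurable_fun setT ((fun x => m (B `&` xsection E x)) : T -> \bar R).
  move=> mB.
  have mEB : measurable (E `&` setT `*` B).
    by apply: measurableI => //; exact: measurableX.
  rewrite (_ : (fun x => _) = m \o xsection (E `&` setT `*` B)).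
    exact: measurable_fun_xsection.
  apply/funext => x /=; congr (m _); apply/seteqP.
  split => y; rewrite /xsection/= !inE.
    by move=> [].
  by move=> [? []].
have split_ball (B : set T) : measurable B ->
    (\int[m]_(x in B) m (A `&` xsection E x) +
     \int[m]_(x in B) m (~` A `&` xsection E x) = c * m B)%E.
  move=> mB; rewrite -ge0_integralD//; last first.
  - by apply: measurable_funTS; exact: mf.
  - by apply: measurable_funTS; exact: mf.
  rewrite -integral_cst//; apply: eq_integral => x _.
  rewrite -(mc x) -measureU//.
  - by rewrite -setIUl setUCr setTI.
  - by apply: measurableI => //; exact: measurable_xsection.
  - by apply: measurableI => //; exact: measurable_xsection.
  - by rewrite setIACA setICr set0I.
have cfin B : measurable B -> (c * m B)%E \is a fin_num.
  move=> mB; rewrite -(mc point) fin_numM// fin_num_measure//.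
  exact: measurable_xsection.
have KA := split_ball _ mA; have KAc := split_ball _ mAc.
have := cfin _ mA; rewrite -KA fin_numD => /andP[_ Kfin].
rewrite -[LHS](addeK _ Kfin) KA mAAc -KAc.
move: Kfin; rewrite (integral_xsection_swap m mE symE mA mAc) => Kfin.
by rewrite addeC addeA [(- _ + _)%E]addeC subee// add0e.
Qed.

(** * Equality of the distributions of distance *)

Theorem theorem1 (R : realType) (n : nat) (n_ge1 : (1 <= n)%N)
    (A : set (sphere R n))
    (mA : (narea R n).-cara.-measurable A)
    (area_eq : mu R n A = mu R n (~` A)) :
  St A = St (~` A) /\ st A = st (~` A).
Proof.
suff StE : St A = St (~` A) by split; [exact: StE|rewrite /st StE].
have mu_fin : fin_num_fun (mu R n).
  move=> B mB; rewrite ge0_fin_numE//.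
  apply: le_lt_trans (narea_setT_lty R n).
  by apply: (le_outer_measure (narea R n)).
pose fin := @Measure_isFinite.Build _ _ _ (mu R n) mu_fin.
pose m : {finite_measure set (caratheodory_type (narea R n)) -> \bar R} :=
  HB.pack (Measure.sort (mu R n)) fin.
apply/funext => l.
pose E : set (caratheodory_type (narea R n) * caratheodory_type (narea R n)) :=
  [set p | dE (p.1 : sphere R n) p.2 < l].
have mE : measurable E.
  rewrite (_ : E = setT `&` (fun p : caratheodory_type (narea R n) *
    caratheodory_type (narea R n) => dE (p.1 : sphere R n) p.2) @^-1` `]-oo, l[).
    by apply: measurable_dE.
  by apply/seteqP; split => p /=; rewrite in_itv/=; [|case].
have ballE (x : sphere R n) : xsection E x = sphere_ball x l.
  by apply/seteqP; split => y; rewrite /xsection/= inE.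
have StE B : (narea R n).-cara.-measurable B ->
    St B l = (\int[m]_(x in B) m (B `&` xsection E x))%E.
  move=> mB; apply: eq_integral => x _.
  rewrite setIC -integral_indic//; last exact: measurable_xsection.
  apply: eq_integral => y _; rewrite ballE indicE /heaviside subr_gt0.
  by rewrite (_ : (y \in sphere_ball x l) = (dE x y < l)) ?mem_setE//; case: ifP.
rewrite (StE _ mA) (StE _ (measurableC mA)).
apply: (@integral_xsection_halves _ _ _ m E
  (narea R n (sphere_ball point l))) => //.
- by move=> x y; rewrite /E/= dE_sym.
- by move=> x; rewrite ballE; exact: narea_sphere_ball.
Qed.
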